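(* Let $I=[-2,2]\subset\mathbb{C}$. There exists a constant $c_1>0$ such that for all sufficiently large $n$, $$A_n(I)\leq\frac{c_1}{n}.$$
   Context: For a complex polynomial $p$, its unit lemniscate is $\Lambda_p=\{z\in\mathbb{C}:|p(z)|<1\}$. For a compact set $K\subset\mathbb{C}$ and $n\in\mathbb{N}$ (with $n\ge 1$), $\mathscr{P}_n(K)$ denotes the set of monic polynomials of degree $n$ all of whose zeros lie in $K$, i.e. $p(z)=\prod_{j=1}^n(z-z_j)$ with $z_j\in K$ (repetitions allowed). Let $m$ be Lebesgue (area) measure on $\mathbb{C}$, and define $A_n(K)=\inf_{p\in\mathscr{P}_n(K)}m(\Lambda_p)$. *)

(* Defs.v *)
From HB Require Import structures.
From mathcomp Require Import all_boot all_order all_algebra.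
From mathcomp Require Import complex.
From mathcomp Require Import all_classical all_reals all_analysis.

Set Implicit Arguments.
Unset Strict Implicit.
Unset Printing Implicit Defensive.

Import Order.TTheory GRing.Theory Num.Theory.

Local Open Scope classical_set_scope.
Local Open Scope ring_scope.
Local Open Scope complex_scope.

(* The norm of R[i] is R[i]-valued, with real values; x < y in R[i] requires
   x and y to have the same imaginary part, so this is |p(z)| < 1 in R. *)
Definition lemniscate (R : realType) (p : {poly R[i]}) : set R[i] :=
  [set z | `|p.[z]| < 1].

Definition monic_polys (R : realType) (n : nat) (K : set R[i]) :
    set {poly R[i]} :=
  [set p | [/\ p \is monic, size p = n.+1 & forall z, root p z -> K z]].

(* R[i] carries no measurable structure in the library: Lebesgue measure on
   the plane is the product measure on R * R, through (x, y) |-> x + iy.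
   It is only meaningful on Borel sets, such as the (open) lemniscates. *)
Definition area (R : realType) (A : set R[i]) : \bar R :=
  (@lebesgue_measure R \x @lebesgue_measure R)%E
    [set xy | A (xy.1 +i* xy.2)].

Definition inf_area (R : realType) (n : nat) (K : set R[i]) : \bar R :=
  ereal_inf [set area (lemniscate p) | p in monic_polys n K].

Definition segment22 (R : realType) : set R[i] :=
  [set x%:C | x in `[(-2 : R), 2]].
Arguments segment22 R : clear implicits.

(* Main.v *)
Require Import Defs.
From mathcomp Require Import all_boot all_order all_algebra.
From mathcomp Require Import complex.
From mathcomp Require Import all_classical all_reals all_analysis.
From mathcomp Require Import measurable_realfun ring.

(** The bound is already satisfied by the lemniscates of the monic Chebyshev
    polynomials T_n of the segment [-2, 2], which are characterised by
    T_n(w + 1/w) = w^n + w^-n (lemma [chebyshev_joukowski]).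

    Every z is of the form w + 1/w with r = |w| >= 1, and |T_n(z)| is then at
    least r^n - r^-n >= n (r - 1).  On the other hand, w + 1/w is within
    O(r - 1) of the segment: its modulus is at most r + 1/r and its imaginary
    part is at most r - 1/r.  Writing e = r - 1, these facts are collected in
    [chebyshev_lower_bound], from which everything else follows:
    - if T_n(z) = 0 then e = 0, so z is real with |z| <= 2, i.e. the zeros of
      T_n lie in the segment;
    - if |T_n(z)| < 1 then e < 1/n, so the lemniscate is contained in the
      rectangle [-3, 3] x [-2/n, 2/n], whose area is 24/n.

    Comparing areas requires the lemniscate to be measurable, which holds
    because the real and imaginary parts of a complex polynomial are polynomial
    in the real coordinates. *)

Set Implicit Arguments.
Unset Strict Implicit.
Unset Printing Implicit Defensive.

Import Order.TTheory GRing.Theory Num.Theory.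

Local Open Scope classical_set_scope.
Local Open Scope ring_scope.

(** The Chebyshev polynomials of the first kind, normalised for the segment
    [-2, 2] instead of [-1, 1]: over the complex numbers this is the polynomial
    sending 2 cos t to 2 cos (n t).  This scaling makes them monic for n > 0. *)
Fixpoint chebyshev (F : comNzRingType) (n : nat) : {poly F} :=
  match n with
  | 0 => 2%:P
  | 1 => 'X
  | (m.+1 as k).+1 => 'X * chebyshev F k - chebyshev F m
  end.

Lemma chebyshevSS (F : comNzRingType) n :
  chebyshev F n.+2 = 'X * chebyshev F n.+1 - chebyshev F n.
Proof. by []. Qed.

Lemma chebyshev_monic_size (F : comNzRingType) n :
  chebyshev F n.+1 \is monic /\ size (chebyshev F n.+1) = n.+2.
Proof.
elim/ltn_ind: n => -[_|n IHn]; first by rewrite monicX size_polyX.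
have [mon_n size_n] := IHn n (ltnSn n).
have size_prev : (size (chebyshev F n) <= n.+1)%N.
  case: n IHn {mon_n size_n} => [|n] IHn; first exact: size_polyC_leq1.
  by have [|_ ->] := IHn n.
have size_lead : size ('X * chebyshev F n.+1) = n.+3.
  by rewrite mulrC size_mulX ?monic_neq0// size_n.
have lt_prev :
    (size (- chebyshev F n)%R < size ('X * chebyshev F n.+1)%R)%N.
  by rewrite size_polyN size_lead ltnS (leq_trans size_prev).
rewrite chebyshevSS size_polyDl// size_lead; split=> //.
by rewrite monicE lead_coefDl// mulrC lead_coefMX -monicE.
Qed.

Lemma chebyshev_joukowski (F : fieldType) n (w : F) : w != 0 ->
  (chebyshev F n).[w + w^-1] = w ^+ n + w ^- n.
Proof.
move=> w0; elim/ltn_ind: n => -[_|[_|n IHn]].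
- by rewrite hornerC expr0 invr1.
- by rewrite hornerX.
- rewrite chebyshevSS hornerD hornerN hornerM hornerX !IHn//.
  rewrite !exprS; field.
  by rewrite w0 expf_neq0.
Qed.

(** The two solutions w of w + 1/w = z are the roots of X^2 - zX + 1, hence
    inverse of each other, so that one of them has modulus at least 1. *)
Lemma joukowski_surj (C : numClosedFieldType) (z : C) :
  exists2 w : C, 1 <= `|w| & z = w + w^-1.
Proof.
pose w := (z + sqrtC (z ^+ 2 - 4)) / 2.
have wE : w * (z - w) = 1.
  have -> : w * (z - w) = (z ^+ 2 - sqrtC (z ^+ 2 - 4) ^+ 2) / 4.
    by rewrite /w; field.
  by rewrite sqrtCK; field.
have w0 : w != 0.
  by apply: contra_eq_neq wE => ->; rewrite mul0r eq_sym oner_neq0.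
have zE : z = w + w^-1.
  by apply: (mulfI w0); rewrite mulrDr divff// -wE; ring.
have [w1|w1] := real_leP (@real1 C) (normr_real w); first by exists w.
exists w^-1; last by rewrite invrK addrC.
by rewrite normfV invf_ge1 ?normr_gt0// ltW.
Qed.

(** A form of Bernoulli's inequality, strong enough to absorb the term r^-n:
    each increment of the left-hand side in n is r - 1, and each increment
    of the right-hand side exceeds it by the nonnegative quantity
    (r - 1)(r^n - 1) + r^-n (1 - 1/r). *)
Lemma ler_bernoulli_sub (F : numFieldType) n (r : F) : 1 <= r ->
  n%:R * (r - 1) <= r ^+ n - r ^- n.
Proof.
move=> r1; have r0 : 0 < r := lt_le_trans ltr01 r1.
elim: n => [|n IHn]; first by rewrite mul0r expr0 invr1 subrr.
rewrite -natr1 mulrDl mul1r (le_trans (lerD IHn (lexx _)))//.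
rewrite -subr_ge0 [leRHS](_ : _ =
  (r - 1) * (r ^+ n - 1) + r ^- n * (1 - r^-1)); last first.
  by rewrite exprS; field; rewrite ?expf_neq0 ?gt_eqF.
rewrite addr_ge0// mulr_ge0 ?subr_ge0 ?exprn_ege1//.
  by rewrite invr_ge0 exprn_ge0 ?ltW.
by rewrite invf_le1.
Qed.

(** The number e, which is |w| - 1 for z = w + 1/w, measures how far z is from
    the segment [-2, 2]; the last inequality says that T_n grows at least
    linearly in n * e away from the segment. *)
Lemma chebyshev_lower_bound (C : numClosedFieldType) n (z : C) :
  exists e : C, [/\ 0 <= e, `|z| <= 2 + e, `|z - z^*| <= 4 * e
    & n%:R * e <= `|(chebyshev C n).[z]|].
Proof.
have [w w1 ->] := joukowski_surj z; exists (`|w| - 1).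
have w0 : 0 < `|w| := lt_le_trans ltr01 w1.
have wn0 : w != 0 by rewrite -normr_gt0.
have wV1 : `|w|^-1 <= 1 by rewrite invf_le1.
have wV2 : 0 <= 1 - `|w| ^- 2.
  by rewrite subr_ge0 invf_le1 ?exprn_gt0 ?exprn_ege1.
split; first by rewrite subr_ge0.
- rewrite (le_trans (ler_normD _ _))// normfV.
  have -> : 2 + (`|w| - 1) = `|w| + 1 by ring.
  exact: lerD.
- have -> : w + w^-1 - (w + w^-1)^* = (w - w^*) * (1 - `|w| ^- 2).
    have -> : (w + w^-1)^* = w^* + `|w| ^- 2 * w.
      by rewrite rmorphD fmorphV normCK /=; field; rewrite conjC_eq0 wn0.
    by rewrite invC_norm; ring.
  rewrite normrM [X in _ * X]ger0_norm//.
  apply: (@le_trans _ _ (2 * `|w| * (1 - `|w| ^- 2))).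
    apply: ler_wpM2r => //.
    by rewrite (le_trans (ler_normB _ _))// norm_conjC mulr2n mulrDl mul1r.
  (* r - 1/r <= 2 (r - 1), because the difference is (r - 1)^2 / r *)
  rewrite -subr_ge0 [leRHS](_ : _ = 2 * (`|w| - 1) ^+ 2 * `|w|^-1).
    by rewrite !mulr_ge0 ?invr_ge0 ?exprn_ge0 ?subr_ge0.
  by field; rewrite gt_eqF.
- rewrite chebyshev_joukowski// (le_trans (ler_bernoulli_sub n w1))//.
  by rewrite -exprVn -normfV -!normrX exprVn -[w ^- n]opprK normrN lerB_dist.
Qed.

Local Open Scope complex_scope.

(** Multiplication by x + iy mixes the real and imaginary parts, so both have
    to be treated in the same induction on the polynomial. *)
Lemma measurable_horner_Re_Im (R : realType) (p : {poly R[i]}) :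
  measurable_fun [set: R * R] (fun xy => complex.Re p.[xy.1 +i* xy.2]) /\
  measurable_fun [set: R * R] (fun xy => complex.Im p.[xy.1 +i* xy.2]).
Proof.
elim/poly_ind: p => [|p c [mRe mIm]].
  by split; rewrite [X in measurable_fun _ X](_ : _ = cst 0)//;
    apply/funext => xy; rewrite horner0.
have horner_step xy : (p * 'X + c%:P).[xy.1 +i* xy.2] =
    (complex.Re p.[xy.1 +i* xy.2] * xy.1 - complex.Im p.[xy.1 +i* xy.2] * xy.2
       + complex.Re c) +i*
    (complex.Re p.[xy.1 +i* xy.2] * xy.2 + complex.Im p.[xy.1 +i* xy.2] * xy.1
       + complex.Im c).
  rewrite hornerMXaddC; case: p.[_] => a b; case: c => c d.
  by rewrite -[LHS]/(_ +i* _).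
split.
  rewrite [X in measurable_fun _ X](_ : _ = fun xy : R * R =>
      complex.Re p.[xy.1 +i* xy.2] * xy.1 - complex.Im p.[xy.1 +i* xy.2] * xy.2
      + complex.Re c); last by apply/funext => xy; rewrite horner_step.
  by apply: measurable_funD => //; apply: measurable_funB;
    apply: measurable_funM.
rewrite [X in measurable_fun _ X](_ : _ = fun xy : R * R =>
    complex.Re p.[xy.1 +i* xy.2] * xy.2 + complex.Im p.[xy.1 +i* xy.2] * xy.1
    + complex.Im c); last by apply/funext => xy; rewrite horner_step.
by apply: measurable_funD => //; apply: measurable_funD; apply: measurable_funM.
Qed.

Lemma measurable_lemniscate (R : realType) (p : {poly R[i]}) :
  measurable [set xy : R * R | lemniscate p (xy.1 +i* xy.2)].
Proof.
have [mRe mIm] := measurable_horner_Re_Im p.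
pose sqnorm (xy : R * R) := complex.Re p.[xy.1 +i* xy.2] ^+ 2 +
  complex.Im p.[xy.1 +i* xy.2] ^+ 2.
have -> : [set xy : R * R | lemniscate p (xy.1 +i* xy.2)] =
    sqnorm @^-1` `]-oo, 1[.
  apply/seteqP; split=> -[x y] /=; rewrite /lemniscate /= in_itv /= /sqnorm /=;
  by rewrite -ltcR add_Re2_Im2 expr_lt1.
rewrite -[X in measurable X]setTI.
have : measurable_fun [set: R * R] sqnorm.
  by apply: measurable_funD; apply: measurable_funX.
by apply => //; exact: measurable_itv.
Qed.

Lemma chebyshev_monic_polys (R : realType) n :
  monic_polys n.+1 (segment22 R) (chebyshev R[i] n.+1).
Proof.
have [mon size_ch] := chebyshev_monic_size R[i] n; split => // z.
have [e [e0 z2 zJ]] := chebyshev_lower_bound n.+1 z.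
rewrite /root => + /eqP p0; rewrite p0 normr0 pmulr_rle0 ?ltr0n// => e_le0.
have e_eq0 : e = 0 by apply/eqP; rewrite eq_le e_le0.
move: z2 zJ; rewrite e_eq0 addr0 mulr0 normr_le0 subr_eq0 => z2 /eqP zJ.
have zE : (complex.Re z)%:C = z by apply/RRe_real/CrealP.
exists (complex.Re z) => //=; rewrite in_itv /= -ler_norml -lecR.
by rewrite (le_trans (normc_ge_Re z))// (le_trans z2)// rmorph_nat.
Qed.

Lemma lemniscate_chebyshev_sub (R : realType) n :
  [set xy : R * R | lemniscate (chebyshev R[i] n.+1) (xy.1 +i* xy.2)] `<=`
  `[-3, 3] `*` `[- (2 / n.+1%:R), 2 / n.+1%:R].
Proof.
move=> [x y]; rewrite /lemniscate /= => lt1.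
have [e [e0 z2 zJ ne]] := chebyshev_lower_bound n.+1 (x +i* y).
have e_le : e <= (n.+1%:R)^-1.
  by rewrite -[leRHS]mul1r ler_pdivlMr ?ltr0n// mulrC (le_trans ne)// ltW.
have e1 : e <= 1 by rewrite (le_trans e_le)// invf_le1 ?ltr0n// ler1n.
rewrite !in_itv /= -!ler_norml; split.
  rewrite -lecR (le_trans (normc_ge_Re (x +i* y)))// (le_trans z2)//.
  by rewrite (le_trans (lerD (lexx _) e1))// rmorph_nat natr1.
have normJ : `|x +i* y - ((x +i* y)^*)%R| = (2 * `|y|)%:C.
  have -> : x +i* y - ((x +i* y)^*)%R = 0 +i* (2 * y).
    by apply/eqP; rewrite eq_complex /=; apply/andP; split; apply/eqP; ring.
  by rewrite normc_def /= expr0n add0r sqrtr_sqr normrM normr_nat.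
have /(le_trans zJ) : 4 * e <= (4 / n.+1%:R)%:C.
  rewrite rmorphM fmorphV !rmorph_nat.
  by rewrite ler_pM2l ?ltr0n.
rewrite normJ lecR [4 / _](_ : _ = 2 * (2 / n.+1%:R)).
  by rewrite ler_pM2l ?ltr0n.
by rewrite mulrA -natrM.
Qed.

Theorem theorem4p1 (R : realType) :
  exists c1 : R, 0 < c1 /\
    \forall n \near \oo, (inf_area n (segment22 R) <= (c1 / n%:R)%:E)%E.
Proof.
exists 24; split; first by rewrite ltr0n.
exists 1%N => // -[//|n] _.
apply: le_trans (ereal_inf_lbound _) _.
  by exists (chebyshev R[i] n.+1); first exact: chebyshev_monic_polys.
set rect := `[-3, 3] `*` `[- (2 / n.+1%:R), 2 / n.+1%:R] : set (R * R).
apply: (@le_trans _ _ ((@lebesgue_measure R \x @lebesgue_measure R)%E rect)).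
  apply: le_measure; [| |exact: lemniscate_chebyshev_sub]; rewrite inE.
    exact: measurable_lemniscate.
  by apply: measurableX; exact: measurable_itv.
have itv_len (r : R) : 0 < r ->
    lebesgue_measure `[- r, r]%classic = (2 * r)%:E.
  by move=> r0; rewrite lebesgue_measure_itv /= lte_fin gtrN// -EFinB opprK
    mulr2n mulrDl mul1r.
have n_gt0 : 0 < 2 / n.+1%:R :> R by rewrite divr_gt0 ?ltr0n.
rewrite product_measure1E; try exact: measurable_itv.
rewrite [X in (X * _)%E](itv_len 3)// [X in (_ * X)%E](itv_len _ n_gt0).
rewrite -EFinM lee_fin [leLHS](_ : _ = 24 / n.+1%:R)//.
by rewrite !mulrA -!natrM.
Qed.
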